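(* Every affine semigroup is an extraction monoid of finite type.
   Context: An affine semigroup is a finitely generated submonoid $M$ of $(\mathbb N^d,+)$ for some positive integer $d$, where $\mathbb N$ denotes the nonnegative integers. For $a,b\in M$, $a\le_M b$ means $b-a\in M$. For $x,y\in M\setminus\{0\}$ the extraction grade is $\lambda_M(x,y)=\sup\{m/n\mid mx\le_M ny,\ m,n\in\mathbb N,\ n\ne0\}\in\mathbb R_+\cup\{\infty\}$. A (commutative, cancellative, reduced) monoid $M$ is an extraction monoid if for any $x,y\in M\setminus\{0\}$ there exist $m\in\mathbb N$ and a positive integer $n$ such that $mx\le_M ny$ and $\lambda_M(x,y)=m/n$. For $x\in M$ let $\mathrm{rad}(x)=\{y\in M\mid x\le_M ny\text{ for some }n\in\mathbb N\}$. An extraction monoid $M$ is of finite type if for any sequence $(x_i)_{i\in\mathbb N}$ in $M$ with $\mathrm{rad}(x_1)\subseteq\mathrm{rad}(x_2)\subseteq\cdots$, this chain becomes stationary. *)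

(* Defs.v *)
From HB Require Import structures.
From mathcomp Require Import all_boot all_order all_algebra.
From mathcomp Require Import all_classical all_reals ereal.
Set Implicit Arguments.
Unset Strict Implicit.
Unset Printing Implicit Defensive.
Import Order.TTheory GRing.Theory Num.Theory.
Local Open Scope classical_set_scope.
Local Open Scope ring_scope.

(* MathComp world.  A commutative monoid is an [nmodType], written additively:
   [x *+ n] is the n-fold sum of [x]. *)

(* A submonoid is given as a closed predicate [S : addrClosed V]; the record
   makes it a monoid in its own right. *)
Record submonoid (V : nmodType) (S : addrClosed V) := Submonoid {
  submonoid_val :> V;
  submonoid_valP : submonoid_val \in S }.

HB.instance Definition _ (V : nmodType) (S : addrClosed V) :=
  [isSub for @submonoid_val V S].
HB.instance Definition _ (V : nmodType) (S : addrClosed V) :=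
  [Choice of submonoid S by <:].
HB.instance Definition _ (V : nmodType) (S : addrClosed V) :=
  GRing.SubChoice_isSubNmodule.Build V _ (submonoid S) (rpred0D S).

Definition finitely_generated (M : nmodType) : Prop :=
  exists s : seq M, forall x : M,
  exists c : 'I_(size s) -> nat, x = \sum_(i < size s) s`_i *+ c i.

Definition affine_semigroup (d : nat) (M : addrClosed 'rV[nat]_d) : Prop :=
  (0 < d)%N /\ finitely_generated (submonoid M).

Definition cancellative (M : nmodType) : Prop :=
  forall a b c : M, a + b = a + c -> b = c.

Definition reduced (M : nmodType) : Prop :=
  forall a b : M, a + b = 0 -> a = 0.

(* [b - a \in M], the difference being taken in the group of fractions. *)
Definition monoid_le (M : nmodType) (a b : M) : Prop :=
  exists c : M, b = a + c.

Definition extraction_grade (R : realType) (M : nmodType) (x y : M) : \bar R :=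
  ereal_sup [set q | exists m n : nat,
    [/\ n != 0%N, monoid_le (x *+ m) (y *+ n) & q = (m%:R / n%:R)%:E]].

Definition extraction_monoid (R : realType) (M : nmodType) : Prop :=
  [/\ cancellative M,
      reduced M &
      forall x y : M, x != 0 -> y != 0 ->
      exists m n : nat,
        [/\ (0 < n)%N,
            monoid_le (x *+ m) (y *+ n) &
            extraction_grade R x y = (m%:R / n%:R)%:E]].

Definition rad (M : nmodType) (x : M) : set M :=
  [set y | exists n : nat, monoid_le x (y *+ n)].

Definition extraction_monoid_of_finite_type (R : realType) (M : nmodType) :
    Prop :=
  extraction_monoid R M /\
  forall x : nat -> M, (forall i, rad (x i) `<=` rad (x i.+1)) ->
  exists N, forall i, (N <= i)%N -> rad (x i) = rad (x N).

(* Main.v *)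
Require Import Defs.
From mathcomp Require Import all_boot all_order all_algebra.
From mathcomp Require Import all_classical all_reals ereal.
Local Open Scope ring_scope.

(** Let [M] be a finitely generated commutative monoid that is cancellative
    and reduced, with generators [s`_i]; submonoids of N^d are cancellative and
    reduced because N^d is.

    The inequality [x *+ m <= y *+ n] holds in [M] iff it can be witnessed by a
    natural solution [(m, n, c)] of [y *+ n = x *+ m + \sum_i s`_i *+ c i].
    Solutions are closed under subtraction whenever the difference is
    coordinatewise nonnegative ([solution_sub]; this uses cancellation).  By
    Dickson's lemma ([dickson]) there is a finite set of solutions with [n > 0]
    such that every solution with [n > 0] lies above one of them; subtracting
    these repeatedly decomposes any solution into a sum of members of the set
    plus a solution with [n = 0], where [m = 0] since [M] is reduced and [x] is
    not 0.  A mediant of fractions never exceeds the largest of them, so the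
    supremum defining the extraction grade is the largest ratio [m / n] in the
    finite set, and in particular it is attained ([grade_attained]).

    For the chain condition, [rad x] depends only on which generators occur in
    an expression of [x]: if those of [x] occur among those of [x'], then
    [x <= x' *+ n] for some [n], hence [rad x'] is included in [rad x].
    So there are finitely many sets [rad x], and every increasing chain
    of them is stationary ([rad_stationary]). *)

Set Implicit Arguments.
Unset Strict Implicit.
Unset Printing Implicit Defensive.
Import Order.TTheory GRing.Theory Num.Theory.
Local Open Scope classical_set_scope.

(** Comparing values of finitely many functions [g : T -> nat], instead of
    tuples, lets the induction on [gs] keep [T] fixed while [A] shrinks to the
    slices where the first function is constant.  If [F] works for [gs] and
    [N] bounds [g] on [F], then [F] still works above the points where
    [g >= N], and the finitely many slices [g = j < N] have finite bases. *)
Lemma dickson (T : eqType) (gs : seq (T -> nat)) (A : set T) :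
  exists F : seq T, (forall f, f \in F -> A f) /\
    forall a, A a -> exists2 f, f \in F & all (fun g => (g f <= g a)%N) gs.
Proof.
elim: gs A => [|g gs IH] A.
  have [[a Aa]|noA] := pselect (exists a, A a); last first.
    by exists [::]; split=> // a Aa; case: noA; exists a.
  by exists [:: a]; split=> [f|b _]; [rewrite inE => /eqP->|exists a; rewrite ?inE].
have [F [FA Fmin]] := IH A.
have /choice[G GP] := fun j => IH [set a | A a /\ g a = j].
pose N := (\max_(f <- F) g f)%N.
exists (F ++ flatten [seq G j | j <- iota 0 N]); split=> [f|a Aa].
  rewrite mem_cat => /orP[/FA //|/flatten_mapP[j _ fG]].
  by have [/(_ _ fG)[]] := GP j.
have [leNa|ltaN] := leqP N (g a).
  have [f fF le_fa] := Fmin a Aa; exists f; first by rewrite mem_cat fF.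
  by rewrite /= le_fa andbT; apply: leq_trans leNa; exact: leq_bigmax_seq.
have [GA Gmin] := GP (g a); have [//|f fG le_fa] := Gmin a.
exists f; last by have [_ /= ->] := GA f fG; rewrite leqnn.
rewrite mem_cat; apply/orP; right; apply/flatten_mapP; exists (g a) => //.
by rewrite mem_iota.
Qed.

Lemma seq_argmax (R : realType) (T : eqType) (g : T -> R) (F : seq T) (f0 : T) :
  f0 \in F -> exists2 f, f \in F & forall h, h \in F -> g h <= g f.
Proof.
elim: F f0 => // a F IH f0 _.
case: F IH => [_|b F /(_ b (mem_head _ _))[f fF maxf]].
  by exists a => [|h]; rewrite ?inE // => /eqP->.
have [le_af|lt_fa] := leP (g a) (g f).
  by exists f => [|h]; rewrite inE ?fF ?orbT // => /orP[/eqP->//|/maxf].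
exists a; first exact: mem_head.
by move=> h; rewrite inE => /orP[/eqP->//|/maxf/le_trans]; apply; exact: ltW.
Qed.

(** Recording the coefficients of the difference of [y *+ n] and [x *+ m] on
    the generators, rather than the difference itself, makes all the data
    natural numbers, to which Dickson's lemma applies. *)
Definition solution (M : nmodType) (s : seq M) (x y : M)
    (v : nat * nat * {ffun 'I_(size s) -> nat}) : Prop :=
  y *+ v.1.2 = x *+ v.1.1 + \sum_(i < size s) s`_i *+ v.2 i.
Arguments solution [M] s x y v.

Lemma solution_sub (M : nmodType) (s : seq M) (x y : M) (m n m' n' : nat)
    (c c' : {ffun 'I_(size s) -> nat}) :
  cancellative M -> (m' <= m)%N -> (n' <= n)%N ->
  (forall i, c' i <= c i)%N ->
  solution s x y (m, n, c) -> solution s x y (m', n', c') ->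
  solution s x y ((m - m')%N, (n - n')%N, [ffun i => (c i - c' i)%N]).
Proof.
rewrite /solution /= => cancelM lem len lec sol sol'.
apply: (cancelM (y *+ n')); rewrite -mulrnDr subnKC // sol sol' addrACA.
rewrite -mulrnDr subnKC // -big_split /=; congr (_ + _).
by apply: eq_bigr => i _; rewrite ffunE -mulrnDr subnKC.
Qed.

Lemma reduced_mulrn_eq0 (M : nmodType) (x : M) (m : nat) :
  reduced M -> x != 0 -> x *+ m = 0 -> m = 0%N.
Proof.
by case: m => // m redM /eqP x0; rewrite mulrS => /redM.
Qed.

Lemma monoid_le_solution (M : nmodType) (s : seq M) (x y : M) (m n : nat) :
  (forall z : M, exists c : 'I_(size s) -> nat,
     z = \sum_(i < size s) s`_i *+ c i) ->
  monoid_le (x *+ m) (y *+ n) -> exists c, solution s x y (m, n, c).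
Proof.
move=> gen [z yE]; have [c zE] := gen z.
exists (finfun c); rewrite /solution /= yE {1}zE; congr (_ + _).
by apply: eq_bigr => i _; rewrite ffunE.
Qed.

(** The bound on the ratios is proved by strong induction on [n], subtracting
    at each step one of the finitely many solutions given by Dickson's lemma.
    Writing it as [m <= q * n] rather than [m / n <= q] makes it additive in the
    solution and meaningful for [n = 0], where it says [m = 0]. *)
Lemma grade_attained (R : realType) (M : nmodType) (x y : M) :
  cancellative M -> reduced M -> finitely_generated M -> x != 0 ->
  exists m n : nat, [/\ (0 < n)%N, monoid_le (x *+ m) (y *+ n) &
    extraction_grade R x y = (m%:R / n%:R)%:E].
Proof.
move=> cancelM redM [s gen] x0.
pose T := (nat * nat * {ffun 'I_(size s) -> nat})%type.
pose gs : seq (T -> nat) := [:: fun v => v.1.1, fun v => v.1.2 &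
  [seq (fun v : T => v.2 i) | i <- enum 'I_(size s)]].
have [F [FS Fmin]] := dickson gs [set v | solution s x y v /\ (0 < v.1.2)%N].
have [f0 f0F] : exists f, f \in F.
  (* [x *+ 0 <= y *+ 1] provides a solution, so [F] is not empty. *)
  have [|c sol] := @monoid_le_solution _ s x y 0 1 gen.
    by exists y; rewrite add0r.
  by have [|f fF _] := Fmin (0%N, 1%N, c); [|exists f].
pose ratio (v : T) : R := v.1.1%:R / v.1.2%:R.
have [[[m0 n0] c0] f1F maxf] := seq_argmax ratio f0F.
have [/= sol0 n0_gt0] := FS _ f1F.
have le0 : monoid_le (x *+ m0) (y *+ n0).
  by exists (\sum_(i < size s) s`_i *+ c0 i).
pose q : R := m0%:R / n0%:R.
have F_bound f : f \in F -> f.1.1%:R <= q * f.1.2%:R.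
  move=> fF; have [_ n_gt0] := FS f fF.
  by rewrite -ler_pdivrMr ?ltr0n //; exact: maxf.
have bound m n c : solution s x y (m, n, c) -> m%:R <= q * n%:R.
  elim/ltn_ind: n m c => n IH m c sol.
  case: (posnP n) => [n_eq0|n_gt0].
    rewrite (_ : m = 0%N) ?n_eq0 ?mulr0 //.
    apply: (reduced_mulrn_eq0 redM x0).
    by move: sol; rewrite /solution /= n_eq0 mulr0n => /esym/redM.
  have [//|[[m' n'] c'] fF /= /and3P[lem len lec]] := Fmin (m, n, c).
  have [/= sol' n'_gt0] := FS _ fF.
  have lec' i : (c' i <= c i)%N.
    by move: lec; rewrite all_map => /allP/(_ i); rewrite mem_enum; apply.
  have sol_sub : solution s x y
      ((m - m')%N, (n - n')%N, [ffun i => (c i - c' i)%N]).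
    exact: solution_sub.
  rewrite -(subnK lem) -(subnK len) !natrD mulrDr lerD //.
    by apply: IH sol_sub; rewrite ltn_subrL n'_gt0.
  exact: (F_bound _ fF).
exists m0, n0; split=> //; apply/eqP; rewrite eq_le; apply/andP; split.
  apply: ge_ereal_sup => _ [m [n [n0' le_mn ->]]].
  have [c sol] := monoid_le_solution gen le_mn.
  by rewrite lee_fin ler_pdivrMr ?ltr0n ?lt0n //; exact: bound sol.
by apply: ereal_sup_ubound; exists m0, n0; rewrite -lt0n.
Qed.

Lemma rad_subset (M : nmodType) (x x' : M) (n : nat) :
  monoid_le x (x' *+ n) -> Defs.rad x' `<=` Defs.rad x.
Proof.
move=> [z x'E] y [k [w yE]]; exists (k * n)%N, (z + w *+ n).
by rewrite mulrnA yE mulrnDl x'E addrA.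
Qed.

(** Take for [n] the largest of the [c i]: then [c i <= c' i * n] whenever
    [c' i > 0]. *)
Lemma monoid_le_support (M : nmodType) (s : seq M)
    (c c' : 'I_(size s) -> nat) :
  (forall i, 0 < c i -> 0 < c' i)%N ->
  exists n, monoid_le (\sum_(i < size s) s`_i *+ c i)
                      ((\sum_(i < size s) s`_i *+ c' i) *+ n).
Proof.
move=> supp; pose n := (\max_(i < size s) c i)%N.
exists n, (\sum_(i < size s) s`_i *+ (c' i * n - c i)).
rewrite -sumrMnl -big_split /=; apply: eq_bigr => i _.
rewrite -mulrnDr subnKC ?mulrnA //.
have [->//|ci_gt0] := posnP (c i).
by rewrite (leq_trans (leq_bigmax i)) // leq_pmull ?supp.
Qed.

Lemma infinitely_often (I : finType) (f : nat -> I) :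
  exists t, forall i, exists2 j, (i <= j)%N & f j = t.
Proof.
apply: contrapT => /forallNP never.
have /choice[B BP] t : exists b, forall j, (b <= j)%N -> f j <> t.
  have /existsNP[b noj] := never t; exists b => j lebj fj.
  by apply: noj; exists j.
by apply: (BP _ (\max_t B t)%N _ erefl); exact: leq_bigmax.
Qed.

(** Some set of generators is the support of infinitely many [x j]; between two
    of those the chain is squeezed, hence constant from the first one on. *)
Lemma rad_stationary (M : nmodType) (x : nat -> M) :
  finitely_generated M -> (forall i, Defs.rad (x i) `<=` Defs.rad (x i.+1)) ->
  exists N, forall i, (N <= i)%N -> Defs.rad (x i) = Defs.rad (x N).
Proof.
move=> [s gen] chain.
have mono i j : (i <= j)%N -> Defs.rad (x i) `<=` Defs.rad (x j).
  move=> /subnK <-; elim: (j - i)%N => // k IH.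
  by apply: subset_trans IH _; rewrite addSn.
have /choice[c cP] := fun i => gen (x i).
pose supp i := [set j | (0 < c i j)%N]%SET.
have [S oftenS] := infinitely_often supp.
have [N _ suppN] := oftenS 0%N.
exists N => i leNi; have [j leij suppj] := oftenS i.
have sub_jN : Defs.rad (x j) `<=` Defs.rad (x N).
  have [k|n] := @monoid_le_support _ s (c N) (c j).
    have /setP/(_ k) : supp N = supp j by rewrite suppN suppj.
    by rewrite !inE => ->.
  by rewrite -!cP; exact: rad_subset.
apply/seteqP; split; last exact: mono.
exact: subset_trans (mono _ _ leij) sub_jN.
Qed.

Lemma submonoid_rV_cancellative (d : nat) (M : addrClosed 'rV[nat]_d) :
  cancellative (submonoid M).
Proof.
move=> a b c /(congr1 val) /= eq_ab; apply: val_inj; apply/rowP => j.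
by move/rowP/(_ j): eq_ab; rewrite !mxE => /addnI.
Qed.

Lemma submonoid_rV_reduced (d : nat) (M : addrClosed 'rV[nat]_d) :
  reduced (submonoid M).
Proof.
move=> a b /(congr1 val) /= eq_ab; apply: val_inj; apply/rowP => j.
by move/rowP/(_ j): eq_ab; rewrite !mxE => /eqP; rewrite addn_eq0 => /andP[/eqP].
Qed.

Theorem lemma12 (R : realType) (d : nat) (M : addrClosed 'rV[nat]_d) :
  affine_semigroup M -> extraction_monoid_of_finite_type R (submonoid M).
Proof.
move=> [_ fgM].
have cancelM := @submonoid_rV_cancellative d M.
have redM := @submonoid_rV_reduced d M.
split; last by move=> x; exact: rad_stationary.
by split=> // x y x0 _; exact: grade_attained.
Qed.
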